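(* Let $d\ge 3$. For any finite sets $A,B\subset \mathbb{Z}^d$, $$\lim_{\|z\|\to\infty}\frac{\mathrm{Cap}(A)+\mathrm{Cap}(B)-\mathrm{Cap}(A\cup(z+B))}{g(z)} = 2\cdot \mathrm{Cap}(A)\cdot\mathrm{Cap}(B),$$ where $z$ ranges over $\mathbb{Z}^d$, $\mathrm{Cap}$ denotes the Newtonian capacity and $g$ the Green's function of simple random walk on $\mathbb{Z}^d$.
   Context: $(S_n)_{n\ge 0}$ is the discrete-time simple random walk on $\mathbb{Z}^d$ started from $0$ (increments uniform over the $2d$ unit vectors $\pm e_i$), $g(x)=\sum_{n\ge 0}\mathbb{P}(S_n=x)$ is its Green's function, and $\mathcal{R}_\infty=\{S_0,S_1,\dots\}$ is its range. $\|\cdot\|$ is the Euclidean norm and $z+B=\{z+b: b\in B\}$. For a finite set $A\subset\mathbb{Z}^d$, the Newtonian capacity is $$\mathrm{Cap}(A)=\lim_{\|z\|\to\infty}\frac{\mathbb{P}\big((z+\mathcal{R}_\infty)\cap A\ne\emptyset\big)}{g(z)},$$ a limit which is well known to exist. *)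

(* Defs.v *)
From HB Require Import structures.
From mathcomp Require Import all_boot all_order all_algebra finmap.
From mathcomp Require Import all_classical all_reals all_analysis.

Set Implicit Arguments.
Unset Strict Implicit.
Unset Printing Implicit Defensive.

Import Order.TTheory GRing.Theory Num.Theory.
Import numFieldNormedType.Exports.

Local Open Scope classical_set_scope.
Local Open Scope ring_scope.

(* Points of the lattice Z^d are integer row vectors. *)
Notation lattice d := 'rV[int]_d.

Definition enorm (R : realType) (d : nat) (z : lattice d) : R :=
  Num.sqrt (\sum_(i < d) (z ord0 i)%:~R ^+ 2).

(* The filter "||z|| -> oo" on Z^d. *)
Definition lattice_infty (R : realType) (d : nat) : set_system (lattice d) :=
  filter_from [set: R] (fun r => [set z | r < enorm R z]).
Arguments lattice_infty : clear implicits.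

Lemma enorm_const (R : realType) (d : nat) (k : nat) : (0 < d)%N ->
  k%:R <= enorm R (const_mx k%:Z : lattice d).
Proof.
case: d => // d _; rewrite /enorm big_ord_recl mxE.
rewrite -[leLHS](ger0_norm (ler0n _ k)) -sqrtr_sqr ler_wsqrtr//.
by rewrite lerDl sumr_ge0// => i _; exact: sqr_ge0.
Qed.

Global Instance lattice_infty_filter (R : realType) (d : nat) :
  Filter (lattice_infty R d).
Proof.
apply: filter_from_filter; first by exists 0.
move=> r s _ _; exists (Num.max r s) => // z /=.
by rewrite gt_max => /andP[].
Qed.

Lemma lattice_infty_proper (R : realType) (d : nat) : (0 < d)%N ->
  ProperFilter (lattice_infty R d).
Proof.
move=> d0; apply: filter_from_proper => r _.
exists (const_mx (Num.bound `|r|)%:Z) => /=.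
apply: lt_le_trans (enorm_const R _ d0).
exact: le_lt_trans (ler_norm r) (archi_boundP (normr_ge0 r)).
Qed.

(* The 2d vectors +e_i and -e_i. *)
Definition unit_steps (d : nat) : set (lattice d) :=
  [set e | exists i : 'I_d, e = delta_mx ord0 i \/ e = - delta_mx ord0 i].

Section Walk.
Context {disp : measure_display} {T : measurableType disp} {R : realType}.
Variables (P : probability T R) (d : nat).
Implicit Type S : nat -> T -> lattice d.

Definition increment S (n : nat) (w : T) : lattice d := S n.+1 w - S n w.

(* Z^d carries the discrete sigma-algebra, so measurability and independence
   are required for arbitrary sets of values. *)
Definition mutually_independent (X : nat -> T -> lattice d) : Prop :=
  forall (J : {fset nat}) (E : nat -> set (lattice d)),
    P (\bigcap_(j in [set` J]) (X j @^-1` E j)) =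
    (\prod_(j <- J) P (X j @^-1` E j))%E.

Record simple_random_walk S : Prop := SimpleRandomWalk {
  srw_measurable : forall n (E : set (lattice d)), measurable (S n @^-1` E) ;
  srw_start : forall w, S 0%N w = 0 ;
  srw_indep : mutually_independent (increment S) ;
  srw_uniform : forall n e, unit_steps e ->
    P (increment S n @^-1` [set e]) = ((2 * d)%:R^-1)%:E }.

(* The series is finite when 3 <= d; "fine" sends the value +oo, which is
   only taken for d <= 2, to 0. *)
Definition green S (x : lattice d) : R :=
  fine (\sum_(0 <= n <oo) P (S n @^-1` [set x]))%E.

Definition walk_range S (w : T) : set (lattice d) := range (fun n => S n w).

Definition translate (z : lattice d) (B : set (lattice d)) : set (lattice d) :=
  [set z + b | b in B].

Definition hitting_probability S (z : lattice d) (A : set (lattice d)) : R :=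
  fine (P [set w | translate z (walk_range S w) `&` A !=set0]).

Definition Cap S (A : set (lattice d)) : R :=
  lim (hitting_probability S z A / green S z @[z --> lattice_infty R d]).

End Walk.

(* Main.v *)
(** Let [Q] be the averaging operator of the walk.

    Green's function.  For large [K], [phi x = (|x|^2 + K)^(-1/4)] is strictly
    [Q]-superharmonic when [d >= 3].  Hence [sum_n Q^n delta_0] is bounded by
    a multiple of [phi], so [g] is finite and tends to [0].

    Ratio limit, [g (z + x) / g z --> 1].  For a unit vector [e] let [L] be the
    limsup of [g (z + e) / g z].  Along an ultrafilter realizing [L] the
    functions [g (z + .) / g z] converge to a positive harmonic [h] with
    [h (x + e) <= L h x] and equality at [x = 0], hence everywhere.  If [L <> 1]
    then [ln h] is superharmonic with a uniform gap, so that
    [ln h + c |x|^2] is strictly superharmonic and tends to infinity for small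
    [c > 0]; at its minimum this is absurd.

    Capacity.  The hitting function [v_A] of [A] vanishes at infinity, so
    [e_A = v_A - Q v_A], which is supported by [A], satisfies
    [v_A x = sum_(a in A) e_A a * g (x - a)] and [Cap A = sum_A e_A].  With
    [C = A U (z + B)] a disjoint union, [v_C = 1] on [A] and the symmetry of
    [g] give [Cap A = sum_(c in C) e_C c * v_A c], and likewise for [z + B],
    whence [Cap A + Cap B - Cap C =
    sum_(b in B) e_C (z + b) * v_A (z + b) + sum_(a in A) e_C a * v_B (a - z)].
    After division by [g z] the factors [v_A (z + b)] and [v_B (a - z)] tend to
    [Cap A] and [Cap B], while the sums of [e_C] over [z + B] and [A] tend to
    [Cap B] and [Cap A]. *)

Require Import Defs.
From HB Require Import structures.
From mathcomp Require Import all_boot all_order all_algebra finmap.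
From mathcomp Require Import all_classical all_reals all_analysis.
From mathcomp Require Import ring lra zify.

Set Implicit Arguments.
Unset Strict Implicit.
Unset Printing Implicit Defensive.

Import Order.TTheory GRing.Theory Num.Theory.
Import numFieldNormedType.Exports.

Local Open Scope classical_set_scope.
Local Open Scope ring_scope.

(** * The lattice and the averaging operator *)

(** Indexing the unit vectors by a sign and a coordinate turns sums over neighbours into sums over a
    finite type. *)
Definition step d (a : bool * 'I_d) : lattice d :=
  if a.1 then delta_mx ord0 a.2 else - delta_mx ord0 a.2.

Definition flip d (a : bool * 'I_d) : bool * 'I_d := (~~ a.1, a.2).

Lemma flipK d : involutive (@flip d).
Proof. by case=> b i; rewrite /flip negbK. Qed.

Lemma step_flip d (a : bool * 'I_d) : step (flip a) = - step a.
Proof. by case: a => -[] i; rewrite /step /= ?opprK. Qed.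

Lemma step_inj d : injective (@step d).
Proof.
move=> [b i] [c j] /matrixP /(_ ord0); rewrite /step.
by case: b; case: c => /= e; move: (e i) (e j);
  rewrite !mxE !eqxx /= (eq_sym j i); case: eqVneq => [->|].
Qed.

Lemma unit_steps_step d (a : bool * 'I_d) : unit_steps (step a).
Proof. by case: a => -[] i; exists i; [left|right]. Qed.

Section Lattice.
Variables (R : realType) (d : nat).
Implicit Types (x y z : lattice d) (f F : lattice d -> R) (a : bool * 'I_d).

Definition average f x : R := (2 * d)%:R^-1 * \sum_a f (x + step a).

Definition is_harmonic f := forall x, average f x = f x.

Definition nsq x : R := \sum_(i < d) (x ord0 i)%:~R ^+ 2.

Lemma nsq_ge0 x : 0 <= nsq x.
Proof. by apply: sumr_ge0 => i _; exact: sqr_ge0. Qed.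

Lemma finite_nsq_le r : finite_set [set x | nsq x <= r].
Proof.
set N := Num.bound `|r|.
have rN : r <= N%:R.
  by apply: le_trans (ler_norm r) _; exact/ltW/archi_boundP.
pose f (h : {ffun 'I_d -> 'I_(2 * N).+1}) : lattice d :=
  \row_i ((h i)%:Z - N%:Z).
apply: (@sub_finite_set _ _ (f @` setT)); last exact/finite_image/finite_finset.
move=> x /= xr.
have xN i : `|x ord0 i| <= N%:Z.
  have : ((x ord0 i) ^+ 2)%:~R <= (N%:Z)%:~R :> R.
    apply: le_trans (le_trans xr rN); rewrite /nsq (bigD1 i)//= rmorphXn/= lerDl.
    by apply: sumr_ge0 => j _; exact: sqr_ge0.
  by rewrite ler_int; nia.
exists [ffun i => inord (absz (x ord0 i + N%:Z))] => //.
apply/rowP => i; rewrite mxE ffunE inordK; have := xN i; move: (x _ _) => k; lia.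
Qed.

(** Balls contain finitely many lattice points, so the filter at infinity is the cofinite filter;
    later arguments use it in this form. *)
Lemma lattice_inftyE (W : set (lattice d)) :
  lattice_infty R d W <-> finite_set (~` W).
Proof.
split=> [[r _ rW]|/finite_seqP[s sW]].
  apply: sub_finite_set (finite_nsq_le (`|r| ^+ 2)) => x /= Wx.
  have : ~~ (r < enorm R x) by apply/negP => h; apply: Wx; exact: rW.
  rewrite -leNgt => h; rewrite -[leLHS]sqr_sqrtr ?nsq_ge0//.
  rewrite ler_sqr ?nnegrE ?sqrtr_ge0//.
  exact: le_trans h (ler_norm _).
exists (\sum_(x <- s) enorm R x) => // z /= sz.
apply: contrapT => Wz.
have zs : z \in s by have : (~` W) z by []; rewrite sW.
move: sz; rewrite (big_rem z)//= ltNge lerDl sumr_ge0// => i _.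
exact: sqrtr_ge0.
Qed.

(** Injections pull finite sets back to finite sets. This serves both [z + b] and [a - z]. *)
Lemma cvg_lattice_infty_inj (h : lattice d -> lattice d) : injective h ->
  h z @[z --> lattice_infty R d] --> lattice_infty R d.
Proof.
move=> hi W /lattice_inftyE fW; apply/lattice_inftyE.
suff: finite_set (h @^-1` (~` W)) by [].
by apply: finite_preimage fW => x y _ _; exact: hi.
Qed.

Lemma finite_argmin F x0 : finite_set [set x | F x <= F x0] ->
  exists m, forall x, F m <= F x.
Proof.
move=> /finite_seqP[s sE].
have sP x : (x \in s) = (F x <= F x0).
  apply/idP/idP => h; first by have : [set` s] x by []; rewrite -sE.
  by have : [set x | F x <= F x0] x by []; rewrite sE.
have x0s : x0 \in s by rewrite sP.
pose i0 : seq_sub s := SeqSub x0s.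
case: (@Order.TotalTheory.arg_minP _ R _ i0 predT (fun i => F (ssval i)) isT) =>
  m _ mP.
exists (ssval m) => x; case: (lerP (F x) (F x0)) => [|/ltW xx0].
  by rewrite -sP => xs; exact: (mP (SeqSub xs)).
exact: le_trans (mP i0 isT) xx0.
Qed.

Hypothesis d_gt0 : (0 < d)%N.

Lemma card_step : #|{: bool * 'I_d}| = (2 * d)%N.
Proof. by rewrite card_prod card_bool card_ord. Qed.

Lemma d2_gt0 : 0 < (2 * d)%:R :> R.
Proof. by rewrite ltr0n muln_gt0. Qed.

Lemma ler_average f F x : (forall y, f y <= F y) -> average f x <= average F x.
Proof.
by move=> fF; rewrite ler_pM2l ?invr_gt0 ?d2_gt0// ler_sum.
Qed.

Lemma average_cst c x : average (cst c) x = c.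
Proof.
rewrite /average sumr_const -[#|_|]/(#|{: bool * 'I_d}|) card_step -(mulr_natl c).
by rewrite mulKf// gt_eqF// d2_gt0.
Qed.

Lemma averageD f F x : average (fun y => f y + F y) x = average f x + average F x.
Proof. by rewrite /average big_split mulrDr. Qed.

Lemma averageZ c f x : average (fun y => c * f y) x = c * average f x.
Proof. by rewrite /average -mulr_sumr mulrCA. Qed.

Lemma averageB f F x : average (fun y => f y - F y) x = average f x - average F x.
Proof. by rewrite /average sumrB mulrBr. Qed.

Lemma average_sum (I : Type) (s : seq I) (f : I -> lattice d -> R) x :
  average (fun y => \sum_(i <- s) f i y) x = \sum_(i <- s) average (f i) x.
Proof. by rewrite /average exchange_big mulr_sumr. Qed.

Lemma average_translate f z x :
  average (fun y => f (y + z)) x = average f (x + z).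
Proof. by rewrite /average; congr (_ * _); apply: eq_bigr => a _;
  rewrite addrAC. Qed.

Lemma average_opp f x : average (fun y => f (- y)) x = average f (- x).
Proof.
rewrite /average; congr (_ * _); rewrite (reindex_inj (inv_inj (@flipK d)))/=.
by apply: eq_bigr => a _; rewrite step_flip opprD opprK.
Qed.

Lemma nsqD_step x a :
  nsq (x + step a) = nsq x + 1 + 2 * ((-1) ^+ (~~ a.1) * (x ord0 a.2)%:~R).
Proof.
case: a => b i /=; rewrite /nsq (bigD1 i)//= [in RHS](bigD1 i)//=.
rewrite (eq_bigr (fun j => (x ord0 j)%:~R ^+ 2)) => [|j ji].
  by case: b; rewrite /step /= !mxE !eqxx /= !rmorphD /= ?rmorphN /=; ring.
by case: b; rewrite /step /= !mxE (negbTE ji)/= ?oppr0 addr0.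
Qed.

Lemma big_steps (h : bool * 'I_d -> R) :
  \sum_a h a = \sum_(i < d) (h (true, i) + h (false, i)).
Proof.
rewrite (eq_bigr (fun a => h (a.1, a.2))) => [|[]//].
by rewrite -(pair_bigA _ (fun b i => h (b, i))) big_bool -big_split.
Qed.

Lemma average_nsq x : average nsq x = nsq x + 1.
Proof.
rewrite -[RHS](average_cst (nsq x + 1) x) /average; congr (_ * _).
rewrite !big_steps; apply: eq_bigr => i _.
by rewrite !nsqD_step/=; ring.
Qed.

(** Minimum principle: a finite sublevel set would provide a global minimum [m], where the average
    is at least [F m]. *)
Lemma no_strict_superharmonic F x0 : (forall x, average F x < F x) ->
  ~ finite_set [set x | F x <= F x0].
Proof.
move=> FF /finite_argmin[m mP]; have := FF m.
by rewrite ltNge -{1}(average_cst (F m) m) ler_average.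
Qed.

End Lattice.

(** * A positive strictly superharmonic function *)

(** A root-free form of $(1+t)^{-1/4} \le 1 - t/4 + t^2/6$. The Taylor coefficient of $t^2$ is $5/32
    < 1/6$, and the slack absorbs the higher terms for small $t$. *)
Lemma quartic_root_expansion (R : realFieldType) (t : R) : `|t| <= 30^-1 ->
  1 <= (1 - t / 4 + t ^+ 2 / 6) ^+ 4 * (1 + t).
Proof.
rewrite ler_norml => /andP[t1 t2].
have t20 := sqr_ge0 t.
(* The exact coefficient of $t^2$ in the square is $19/48 = 7/18 + 1/144$. *)
have s1 : 1 - t / 2 + 7 / 18 * t ^+ 2 <= (1 - t / 4 + t ^+ 2 / 6) ^+ 2.
  rewrite -subr_ge0.
  have -> : (1 - t / 4 + t ^+ 2 / 6) ^+ 2 - (1 - t / 2 + 7 / 18 * t ^+ 2) =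
    t ^+ 2 * (1 / 144 - t / 12 + t ^+ 2 / 36) by field.
  apply: (mulr_ge0 t20); lra.
have s0 : 0 <= 1 - t / 2 + 7 / 18 * t ^+ 2 by lra.
apply: (@le_trans _ _ ((1 - t / 2 + 7 / 18 * t ^+ 2) ^+ 2 * (1 + t))); last first.
  rewrite (exprM _ 2 2) ler_pM2r; last by lra.
  by rewrite ler_sqr ?nnegrE// (le_trans s0 s1).
rewrite -subr_ge0.
have -> : (1 - t / 2 + 7 / 18 * t ^+ 2) ^+ 2 * (1 + t) - 1 = t ^+ 2 *
  (1 / 36 + t * (23 / 36) + t ^+ 2 * (- (77 / 324) + t * (49 / 324))) by field.
apply: (mulr_ge0 t20).
have : `|t ^+ 2 * (- (77 / 324) + t * (49 / 324))| <= 30^-1 * 30^-1.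
  rewrite normrM normrX expr2 -mulrA; apply: ler_pM => //; rewrite ?ler_norml ?t1//.
  rewrite -[30^-1]mulr1; apply: ler_pM; rewrite ?ler_norml ?t1//; lra.
by rewrite ler_norml => /andP[t3 t4]; lra.
Qed.

(** Let $q = |x|^2 + K$ and let $t$ be the relative increment of $q$ over one step. The mean of $t$
    is $1/q$ and that of $t^2$ is $(1 + 4|x|^2/d)/q^2$, so to leading order averaging multiplies
    [phi] by at most $1 - (1/4 - 2/(3d))/q$. The bracket is positive exactly when $d \ge 3$. *)
Lemma lyapunov (R : realType) (d : nat) : (3 <= d)%N ->
  exists phi : lattice d -> R, [/\ forall x, 0 < phi x,
    forall x, average phi x < phi x &
    phi x @[x --> lattice_infty R d] --> (0 : R)].
Proof.
move=> d3; have d0 : (0 < d)%N by exact: leq_trans d3.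
(* For [|t a| <= 30^-1] one needs $30 + 60k \le k^2 + K$ with $k = |x_i|$, which follows from $(k -
   30)^2 \ge 0$ once $K \ge 30 \cdot 31$. The summand [d] makes [8 * K - 2 * d] nonnegative at the
   end. *)
pose K : R := (30 * 31) + d%:R.
pose q (x : lattice d) := nsq R x + K.
have K0 : 0 < K by rewrite ltr_wpDr.
have q0 x : 0 < q x by rewrite ltr_wpDl// nsq_ge0.
pose phi (x : lattice d) : R := (Num.sqrt (Num.sqrt (q x)))^-1.
have phi0 x : 0 < phi x by rewrite invr_gt0 !sqrtr_gt0.
have phi4 x : phi x ^+ 4 = (q x)^-1.
  by rewrite exprVn (exprM _ 2 2) !sqr_sqrtr// ?sqrtr_ge0// ltW.
exists phi; split => // [x|]; last first.
  apply/cvgrPdist_lt => e e0; apply/lattice_inftyE.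
  apply: sub_finite_set (finite_nsq_le d (e ^- 4)) => x /= /negP.
  rewrite sub0r normrN gtr0_norm// -leNgt => ex.
  have : q x <= e ^- 4.
    by rewrite -[leLHS]invrK -phi4 lef_pV2 ?posrE ?exprn_gt0// lerXn2r ?nnegrE//
      ltW.
  by apply: le_trans; rewrite lerDl ltW.
pose t a := (q (x + step a) - q x) / q x.
have tE a : t a = (1 + 2 * ((-1) ^+ (~~ a.1) * (x ord0 a.2)%:~R)) / q x.
  by rewrite /t /q nsqD_step; congr (_ / _); ring.
have t_small a : `|t a| <= 30^-1.
  rewrite tE normrM normfV (gtr0_norm (q0 x)) ler_pdivrMr//.
  apply: le_trans (ler_normD _ _) _; rewrite !normrM normrX normrN1 expr1n mul1r.
  rewrite normr1 (ger0_norm (ler0n _ 2)) ler_pdivlMl//.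
  have : `|(x ord0 a.2)%:~R| ^+ 2 <= nsq R x.
    rewrite real_normK ?num_real// /nsq (bigD1 a.2)//= lerDl.
    by apply: sumr_ge0 => i _; exact: sqr_ge0.
  have : 0 <= (`|(x ord0 a.2)%:~R| - 30 : R) ^+ 2 by exact: sqr_ge0.
  have : (0 : R) <= d%:R by [].
  rewrite /q /K; nra.
have phi_step a : phi (x + step a) <= phi x * (1 - t a / 4 + t a ^+ 2 / 6).
  have := t_small a; rewrite ler_norml => /andP[t1 t2].
  have p0 : 0 < 1 - t a / 4 + t a ^+ 2 / 6 by have := sqr_ge0 (t a); lra.
  rewrite -(@ler_pXn2r _ 4)// ?nnegrE ?(ltW (phi0 _))// ?mulr_ge0 ?(ltW p0) ?(ltW
    (phi0 _))//.
  rewrite exprMn !phi4.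
  have -> : q (x + step a) = q x * (1 + t a) by rewrite /t; field; rewrite gt_eqF.
  rewrite invfM ler_pM2l ?invr_gt0// -div1r ler_pdivrMr; last by lra.
  by rewrite quartic_root_expansion.
have : average phi x <= average (fun y => phi x * (1 - (q y - q x) / q x / 4 +
  ((q y - q x) / q x) ^+ 2 / 6)) x.
  by rewrite ler_pM2l ?invr_gt0 ?d2_gt0// ler_sum// => a _; exact: phi_step.
move=> /le_lt_trans; apply.
rewrite averageZ// gtr_pMr// /average ltr_pdivrMl ?d2_gt0// mulr1 big_steps.
rewrite (eq_bigr (fun i => 2 - (2 * q x)^-1 + (2 + 8 * (x ord0 i)%:~R ^+ 2) / 6 /
  q x ^+ 2)); last first.
  move=> i _; rewrite -!/(t _) !tE /=; field; rewrite gt_eqF//.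
rewrite big_split/= sumr_const card_ord -!mulr_suml big_split/= sumr_const
  card_ord -mulr_sumr.
rewrite -/(nsq R x) -[_ *+ d]mulr_natl -[2 *+ d]mulr_natl natrM.
have n0 := nsq_ge0 R x; have d3' : 3 <= d%:R :> R by rewrite ler_nat.
have -> : nsq R x = q x - K by rewrite /q addrK.
rewrite -subr_gt0.
have -> : 2 * d%:R - (d%:R * (2 - (2 * q x)^-1) + (d%:R * 2 + 8 * (q x - K)) / 6
  / q x ^+ 2)
  = (3 * d%:R * q x - 8 * q x + (8 * K - 2 * d%:R)) / 6 / q x ^+ 2.
  by field; rewrite gt_eqF.
rewrite !divr_gt0 ?exprn_gt0// ltr_wpDr//; first by rewrite /K; lra.
by rewrite -mulrBl mulr_gt0//; lra.
Qed.

(** * Green's function *)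

Section Green.
Variables (R : realType) (d : nat).
Implicit Types (x y z : lattice d) (f g : lattice d -> R) (a : bool * 'I_d).

Definition delta0 x : R := (x == 0)%:R.

Definition partial_green n x : R := \sum_(k < n) iter k (@average R d) delta0 x.

(** Describes Green's function by the averaging operator alone; [green_is_green] makes the link with
    the walk. *)
Definition is_green g := forall x, partial_green n x @[n --> \oo] --> g x.

Lemma partial_greenS n x :
  partial_green n.+1 x = delta0 x + average (partial_green n) x.
Proof. by rewrite /partial_green big_ord_recl average_sum. Qed.

Lemma cvg_average (u : nat -> lattice d -> R) f x :
  (forall y, u n y @[n --> \oo] --> f y) ->
  average (u n) x @[n --> \oo] --> average f x.
Proof.
by move=> uf; apply: cvgMl_tmp; apply: cvg_big => [|a _];
  [exact: add_continuous|exact: uf].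
Qed.

Hypothesis d3 : (3 <= d)%N.
Let d0 : (0 < d)%N. Proof. exact: leq_trans d3. Qed.

Lemma iter_average_ge0 k f x : (forall y, 0 <= f y) ->
  0 <= iter k (@average R d) f x.
Proof.
move=> f0; elim: k x => //= k IH x.
by rewrite mulr_ge0 ?invr_ge0// sumr_ge0.
Qed.

Lemma delta0_ge0 x : 0 <= delta0 x. Proof. exact: ler0n. Qed.

Lemma partial_green_nd x : nondecreasing_seq (partial_green ^~ x).
Proof.
apply/nondecreasing_seqP => n; rewrite /partial_green big_ord_recr/= lerDl.
exact: iter_average_ge0 delta0_ge0.
Qed.

(** Scale the Lyapunov function so that [phi - average phi] is at least [delta0]; the recursion
    [partial_greenS] then preserves the bound. *)
Lemma partial_green_bound : exists phi : lattice d -> R,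
  phi x @[x --> lattice_infty R d] --> (0 : R) /\
  forall n x, 0 <= partial_green n x <= phi x.
Proof.
have [phi [phi0 phiS phiC]] := lyapunov R d3.
have c0 : 0 < phi 0 - average phi 0 by rewrite subr_gt0.
exists (fun x => (phi 0 - average phi 0)^-1 * phi x); split.
  by rewrite -[X in _ --> X](mulr0 (phi 0 - average phi 0)^-1); exact: cvgMl_tmp.
move=> n x; apply/andP; split.
  by apply: sumr_ge0 => k _; exact: iter_average_ge0 delta0_ge0.
rewrite ler_pdivlMl//.
elim: n x => [|n IH] x; first by rewrite /partial_green big_ord0 mulr0 ltW.
rewrite partial_greenS mulrDr.
have : (phi 0 - average phi 0) * delta0 x <= phi x - average phi x.
  rewrite /delta0; case: eqVneq => [->|_]; first by rewrite mulr1.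
  by rewrite mulr0 subr_ge0 ltW.
have : (phi 0 - average phi 0) * average (partial_green n) x <= average phi x.
  by rewrite -averageZ ler_average.
lra.
Qed.

Lemma cvg_partial_green x : cvgn (partial_green ^~ x).
Proof.
have [phi [_ phiP]] := partial_green_bound.
apply: nondecreasing_is_cvgn; first exact: partial_green_nd.
by exists (phi x) => _ [n _ <-]; have /andP[] := phiP n x.
Qed.

Variable g : lattice d -> R.
Hypothesis gP : is_green g.

Lemma partial_green_le n x : partial_green n x <= g x.
Proof.
apply: (cvgr_to_ge (@gP x)); exists n => // m nm.
exact: partial_green_nd.
Qed.

Lemma green_average x : g x = delta0 x + average g x.
Proof.
have := @gP x; rewrite -(cvg_shiftS (partial_green ^~ x)) => h.
rewrite -(cvg_lim _ h)//; apply: cvg_lim => //.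
under eq_fun do rewrite partial_greenS.
by apply: cvgD; [exact: cvg_cst | exact: cvg_average].
Qed.

Lemma green_ge0 x : 0 <= g x.
Proof. by apply: le_trans (partial_green_le 0 x);
  rewrite /partial_green big_ord0. Qed.

(** A Harnack bound: one nonnegative term of the average is at most the whole sum. *)
Lemma green_step x a : g (x + step a) <= (2 * d)%:R * g x.
Proof.
rewrite (green_average x) mulrDr /average mulVKf ?gt_eqF ?d2_gt0//.
rewrite (bigD1 a)//= addrCA lerDl addr_ge0// ?mulr_ge0 ?delta0_ge0//.
by rewrite sumr_ge0// => b _; exact: green_ge0.
Qed.

Lemma cvg_green : g x @[x --> lattice_infty R d] --> (0 : R).
Proof.
have [phi [phi0 phiP]] := partial_green_bound.
have F := lattice_infty_filter R d.
apply: (@squeeze_cvgr _ _ _ _ (cst 0) phi) => //; last exact: cvg_cst.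
apply: nearW => x; rewrite green_ge0/=.
apply: (cvgr_to_le (@gP x)).
by apply: nearW => n; have /andP[] := phiP n x.
Qed.

Lemma iter_average_opp k x :
  iter k (@average R d) delta0 (- x) = iter k (@average R d) delta0 x.
Proof.
elim: k x => [|k IH] x; first by rewrite /= /delta0 oppr_eq0.
rewrite /= -average_opp; rewrite /average; congr (_ * _).
by apply: eq_bigr => a _; exact: IH.
Qed.

Lemma green_opp x : g (- x) = g x.
Proof.
have e : partial_green ^~ (- x) = partial_green ^~ x.
  by apply/funext => n; apply: eq_bigr => k _; rewrite iter_average_opp.
by have := @gP (- x); rewrite e => h; apply: cvg_unique h (@gP x).
Qed.

End Green.

(** * A Liouville property for positive harmonic functions *)

(** The graph distance from 0 to [x], used as induction measure. *)
Definition l1 d (x : lattice d) : nat := \sum_(i < d) absz (x ord0 i).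

Lemma l1_pred d (x : lattice d) : x != 0 -> exists a, l1 x = (l1 (x - step a)).+1.
Proof.
move=> x0; have [i xi] : exists i, x ord0 i != 0.
  by apply/existsP; rewrite -negb_forall; apply: contra x0 => /forallP h;
    apply/eqP/rowP => i; rewrite mxE; exact/eqP/h.
exists (0 < x ord0 i, i); rewrite /l1 (bigD1 i)//= [in RHS](bigD1 i)//=.
have -> : \sum_(j < d | j != i) absz ((x - step (0 < x ord0 i, i))%R ord0 j) =
    \sum_(j < d | j != i) absz (x ord0 j).
  apply: eq_bigr => j ji; rewrite /step /=.
  by case: ifP => _; rewrite !mxE (negbTE ji)/= ?oppr0 subr0.
rewrite -addSn; congr addn; rewrite /step /=.
by case: ifPn => h; rewrite !mxE !eqxx /=; move: xi h; move: (x _ _) => k; lia.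
Qed.

Lemma l1N d (x : lattice d) : l1 (- x) = l1 x.
Proof. by apply: eq_bigr => i _; rewrite mxE abszN. Qed.

Lemma lattice_ind d (Q : lattice d -> Prop) : Q 0 ->
  (forall x a, Q x -> Q (x + step a)) -> forall x, Q x.
Proof.
move=> Q0 QS x; have [n] := ubnP (l1 x); elim: n x => // n IH x xn.
have [->//|x0] := eqVneq x 0; have [a xa] := l1_pred x0.
by rewrite -(subrK (step a) x); apply/QS/IH; rewrite -ltnS -xa.
Qed.

(** By compactness of the segment there is a cluster point, and an ultrafilter converges to its
    cluster points. *)
Lemma cvg_ultra_bounded (R : realType) (T : Type) (U : set_system T) (f : T -> R)
  (m M : R) : UltraFilter U -> (\forall z \near U, m <= f z <= M) ->
  exists l : R, f z @[z --> U] --> l.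
Proof.
move=> UU fmM; have UP := @ultra_proper _ _ UU.
have [] := @segment_compact R m M (fmap f U) _.
  by apply: filterS fmM => z /=; rewrite in_itv.
move=> l [_ cl]; exists l => V Vl.
case: (in_ultra_setVsetC (f @^-1` V) UU) => // UV.
by have [x []] := cl (~` V) V UV Vl.
Qed.

Section Ratio.
Variables (R : realType) (d : nat) (d0 : (0 < d)%N).
Implicit Types (x y z : lattice d) (f g h : lattice d -> R) (a : bool * 'I_d).

Let D : R := (2 * d)%:R.
Let D0 : 0 < D. Proof. exact: d2_gt0. Qed.

Lemma harmonic_step h x a : (forall y, 0 < h y) -> average h x = h x ->
  h (x + step a) <= D * h x.
Proof.
move=> h0 <-; rewrite /average mulVKf ?gt_eqF//.
by rewrite (bigD1 a)//= lerDl sumr_ge0// => b _; exact/ltW.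
Qed.

(** Each step costs a factor [D]; follow a shortest lattice path to [y]. *)
Lemma growth_step h : (forall y, 0 < h y) ->
  (forall x a, h (x + step a) <= D * h x) ->
  forall x y, h (x + y) <= D ^+ l1 y * h x.
Proof.
move=> h0 hs x y; have [n] := ubnP (l1 y); elim: n y => // n IH y yn.
have [->|y0] := eqVneq y 0.
  rewrite addr0 (_ : l1 0 = 0%N) ?mul1r//.
  by rewrite /l1 big1// => i _; rewrite mxE.
have [a ya] := l1_pred y0.
rewrite ya exprS -mulrA -{1}(subrK (step a) y) addrA.
by apply: le_trans (hs _ _) _; rewrite ler_pM2l// IH// -ltnS -ya.
Qed.

Lemma ln_lt_sub1 (L : R) : 0 < L -> L != 1 -> ln L < L - 1.
Proof.
move=> L0 L1; rewrite ltrBrDl -[ltRHS](lnK L0).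
by apply: expR_gt1Dx; rewrite ln_eq0.
Qed.

(** The inequality $\ln u \le u - 1$ for the ratios $u = h(x+b)/h(x)$ sums to 0 over [b] by
    harmonicity, and the term [b = a] has the slack $L - 1 - \ln L > 0$ at every [x]. This
    contradicts the minimum principle for a coercive perturbation of [ln h]. *)
Lemma harmonic_multiplier h a L : (forall x, 0 < h x) -> is_harmonic h ->
  (forall x, h (x + step a) = L * h x) -> L = 1.
Proof.
move=> h0 hh hL; apply/eqP/negPn/negP => L1.
have L0 : 0 < L by have := h0 (0 + step a); rewrite hL pmulr_lgt0.
pose e := (L - 1 - ln L) / D.
have e0 : 0 < e by rewrite divr_gt0// subr_gt0 ln_lt_sub1.
have lnh x : average (fun y => ln (h y)) x <= ln (h x) - e.
  rewrite -[X in X - e](average_cst d0 (ln (h x)) x) -lerBlDl -averageB.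
  rewrite /average mulrC ler_pdivrMr// /e mulNr divfK ?gt_eqF//.
  apply: (@le_trans _ _ (\sum_b ((h (x + step b) / h x - 1) - (b == a)%:R * (L -
    1 - ln L)))).
    apply: ler_sum => b _ /=; rewrite -ln_div ?posrE//.
    case: eqVneq => [->|_].
      by rewrite hL mulfK ?gt_eqF// mul1r; lra.
    rewrite mul0r subr0; have := @le_ln1Dx R (h (x + step b) / h x - 1).
    by rewrite addrCA subrr addr0; apply; rewrite ltrBrDl subrr divr_gt0.
  rewrite sumrB sumrB -mulr_suml -mulr_suml.
  have -> : \sum_b (b == a)%:R = 1 :> R.
    by rewrite (bigD1 a)//= eqxx big1 ?addr0// => b ba; rewrite (negbTE ba).
  have -> : \sum_b h (x + step b) = D * h x.
    by rewrite -(hh x) /average mulVKf// gt_eqF.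
  by rewrite mulfK ?gt_eqF// sumr_const card_step subrr sub0r mul1r.
(* Averaging raises [nsq] by 1, so the coefficient [e / 2] uses only half of the gap [e]. *)
pose F x := ln (h x) + e / 2 * nsq R x.
have hgrow := growth_step h0 (fun x b => harmonic_step b h0 (hh x)).
apply: (@no_strict_superharmonic R d d0 F 0).
  move=> x; rewrite /F averageD averageZ average_nsq//.
  have := lnh x; lra.
apply: sub_finite_set (finite_nsq_le d (4 / e * (d%:R * (ln D ^+ 2 / e)))) => x /=.
have h1 : ln (h 0) - (l1 x)%:R * ln D <= ln (h x).
  rewrite lerBlDl mulr_natl -lnXn// -lnM ?posrE ?exprn_gt0// ler_ln ?posrE//.
    by have := hgrow x (- x); rewrite subrr l1N.
  by rewrite mulr_gt0// exprn_gt0.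
(* Coordinatewise $k \ln D \le (e/4) k^2 + (\ln D)^2/e$: the linear decay of [ln h] costs half of
   the quadratic term. *)
have h2 : (l1 x)%:R * ln D <= e / 4 * nsq R x + d%:R * (ln D ^+ 2 / e).
  rewrite /l1 natr_sum mulr_suml /nsq mulr_sumr.
  have -> : d%:R * (ln D ^+ 2 / e) = \sum_(i < d) (ln D ^+ 2 / e).
    by rewrite sumr_const card_ord mulr_natl.
  rewrite -big_split/= ler_sum// => i _.
  have -> : (absz (x ord0 i))%:R = `|(x ord0 i)%:~R| :> R.
    by rewrite -intr_norm -abszE.
  rewrite -[X in e / 4 * X]real_normK ?num_real//; set k := `|_|.
  rewrite -subr_ge0 (_ : _ - _ = (e * k / 2 - ln D) ^+ 2 / e).
    by rewrite divr_ge0 ?sqr_ge0// ltW.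
  by field; rewrite gt_eqF.
have nsq00 : nsq R (0 : lattice d) = 0.
  by rewrite /nsq big1// => i _; rewrite mxE expr0n.
rewrite /F nsq00 mulr0 addr0 => Fx.
rewrite mulrAC ler_pdivlMr// mulrC; lra.
Qed.

(* The set where the maximal ratio [L] is attained is stable under unit steps. *)
Lemma harmonic_pos_max h a L : (forall x, 0 < h x) -> is_harmonic h ->
  (forall x, h (x + step a) <= L * h x) -> h (step a) = L * h 0 -> L = 1.
Proof.
move=> h0 hh hL h0L; apply: (harmonic_multiplier h0 hh) => //.
apply: (lattice_ind (Q := fun x => h (x + step a) = L * h x));
  first by rewrite add0r.
move=> x b xL; apply/eqP; rewrite eq_le hL/= leNgt; apply/negP => lt.
suff : average (fun y => h (y + step a)) x < average (fun y => L * h y) x.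
  by rewrite average_translate averageZ !hh xL ltxx.
rewrite /average ltr_pM2l ?invr_gt0//.
rewrite (bigD1 b)//= [ltRHS](bigD1 b)//= ltr_leD//.
by apply: ler_sum => c _; exact: hL.
Qed.

End Ratio.

(** * Ratio limit of Green's function *)

Section RatioLimit.
Variables (R : realType) (d : nat) (d3 : (3 <= d)%N).
Variables (g : lattice d -> R) (gP : is_green g).
Implicit Types (x y z : lattice d) (a : bool * 'I_d).

Let d0 : (0 < d)%N. Proof. exact: leq_trans d3. Qed.
Let D : R := (2 * d)%:R.
Let D0 : 0 < D. Proof. exact: d2_gt0. Qed.
Let F := lattice_infty R d.
Let FP : ProperFilter F. Proof. exact: lattice_infty_proper. Qed.

(** Positivity at 0 comes from [delta0] and spreads along unit steps by the Harnack bound. *)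
Lemma green_gt0 x : 0 < g x.
Proof.
have g_step y a : g y <= D * g (y + step a).
  by have := green_step d3 gP (y + step a) (flip a); rewrite step_flip addrK.
apply: (lattice_ind (Q := fun x => 0 < g x)) => [|y a].
  rewrite (green_average gP) /delta0. rewrite eqxx ltr_wpDr// /average.
  rewrite mulr_ge0 ?invr_ge0// sumr_ge0// => a _; exact: green_ge0.
by move=> /lt_le_trans /(_ (g_step y a)); rewrite pmulr_rgt0.
Qed.

Lemma green_growth x y : g (x + y) <= D ^+ l1 y * g x.
Proof. exact: (growth_step d0 green_gt0 (green_step d3 gP)). Qed.

Lemma green_ratio_bounds x y : (D ^+ l1 y)^-1 <= g (x + y) / g x <= D ^+ l1 y.
Proof.
rewrite ler_pdivrMr ?green_gt0// green_growth andbT ler_pdivlMr ?green_gt0//.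
rewrite ler_pdivrMl ?exprn_gt0//.
by have := green_growth (x + y) (- y); rewrite addrK l1N.
Qed.

Lemma cvg_translate_infty y : z + y @[z --> F] --> F.
Proof. by apply: cvg_lattice_infty_inj => u v /addIr. Qed.

Lemma near_lattice_infty_neq y : \forall z \near F, z != y.
Proof.
apply/lattice_inftyE; apply: sub_finite_set (finite_set1 y) => z /= /negP.
by rewrite negbK => /eqP.
Qed.

Section UltraLimit.
Variables (U : set_system (lattice d)) (UU : UltraFilter U) (FU : F `<=` U).
Let UP : ProperFilter U. Proof. exact: ultra_proper. Qed.

Lemma green_ultra_limit : exists h : lattice d -> R,
  [/\ forall x, g (z + x) / g z @[z --> U] --> h x, h 0 = 1,
      forall x, 0 < h x & is_harmonic h].
Proof.
have /choice[h hP] x : exists l : R, g (z + x) / g z @[z --> U] --> l.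
  apply: (@cvg_ultra_bounded _ _ _ _ ((D ^+ l1 x)^-1) (D ^+ l1 x)) => //.
  by apply: nearW => z; exact: green_ratio_bounds.
exists h; split => //.
- have h1 : g (z + 0) / g z @[z --> U] --> (1 : R).
    under eq_fun do rewrite addr0 divff ?gt_eqF ?green_gt0//.
    exact: cvg_cst.
  exact: cvg_unique (hP 0) h1.
- move=> x; apply: (@lt_le_trans _ _ ((D ^+ l1 x)^-1)).
    by rewrite invr_gt0 exprn_gt0.
  apply: (cvgr_to_ge (hP x)); apply: nearW => z.
  by have /andP[] := green_ratio_bounds z x.
- move=> x.
  have h1 : average (fun y => g (z + y) / g z) x @[z --> U] --> average h x.
    apply: cvgMl_tmp; apply: cvg_big => [|a _]; [exact: add_continuous|exact: hP].
  have h2 : g (z + x) / g z @[z --> U] --> average h x.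
    apply: cvg_trans h1; apply: near_eq_cvg.
    (* The only point where [g] is not harmonic is 0, and [z + x] differs from 0 for [z] near
       infinity. *)
    have := FU (near_lattice_infty_neq (- x)).
    apply: filterS => z zx /=.
    have -> : average (fun y => g (z + y) / g z) x = average g (z + x) / g z.
      by rewrite /average -mulr_suml mulrA; congr (_ * _ / _);
        apply: eq_bigr => a _; rewrite addrA.
    by rewrite [in RHS](green_average gP) /delta0 addr_eq0 (negbTE zx) add0r.
  exact: cvg_unique h2 (hP x).
Qed.

End UltraLimit.

(** The infimum [L] of the eventual upper bounds is the limsup of the ratio. It is realized along an
    ultrafilter, whose limit function has maximal ratio [L] at 0, which forces [L = 1]. *)
Lemma green_ratio_ub a e : 0 < e ->
  \forall z \near F, g (z + step a) / g z <= 1 + e.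
Proof.
move=> e0; pose r z := g (z + step a) / g z.
pose C := [set c | \forall z \near F, r z <= c].
have C1 : C (D ^+ l1 (step a)).
  by apply: nearW => z; have /andP[] := green_ratio_bounds z (step a).
have Clb : has_lbound C.
  exists 0 => c Cc; have [z /= zc] := @filter_ex _ F FP _ Cc; apply: le_trans zc.
  by rewrite /r divr_ge0// ltW// green_gt0.
have Cinf : has_inf C by split => //; exists (D ^+ l1 (step a)).
pose L := inf C.
have LP k : 0 < k -> \forall z \near F, r z <= L + k.
  move=> k0; have [c Cc ck] := inf_adherent k0 Cinf.
  by apply: filterS Cc => z /le_trans; apply; exact: ltW.
have LN k : 0 < k -> ~ \forall z \near F, r z <= L - k.
  move=> k0 /(ge_inf Clb); rewrite -/L; lra.
suff L1 : L <= 1.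
  by apply: filterS (LP _ e0) => z /le_trans; apply; rewrite lerD2r.
(* [G] adds to [F] the sets where the ratio exceeds [L - k]; it is proper because no [L - k] is an
   eventual upper bound. *)
pose G := filter_from [set p : set (lattice d) * R | F p.1 /\ 0 < p.2]
  (fun p => p.1 `&` [set z | L - p.2 < r z]).
have GP : ProperFilter G.
  apply: filter_from_proper.
    apply: filter_from_filter; first by exists (setT, 1); split => //;
      exact: filterT.
    move=> [W1 k1] [W2 k2] /= [FW1 k10] [FW2 k20].
    exists (W1 `&` W2, Num.min k1 k2).
      by split; [exact: filterI | rewrite lt_min k10].
    move=> z /= [[W1z W2z] Lz].
    have [m1 m2] : Num.min k1 k2 <= k1 /\ Num.min k1 k2 <= k2.
      by rewrite !ge_min !lexx orbT.
    by split; split => //; apply: le_lt_trans Lz; rewrite lerD2l lerN2.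
  move=> [W k] /= [FW k0]; apply: contrapT => W0; apply: (LN _ k0).
  apply: filterS FW => z Wz; rewrite leNgt; apply/negP => Lz.
  by apply: W0; exists z.
have [U [UU GU]] := ultraFilterLemma GP.
have FU : F `<=` U.
  by move=> W FW; apply: GU; exists (W, 1) => // z /= [].
have rU : r z @[z --> U] --> L.
  apply/cvgrPdist_le => k k0.
  have h1 : U [set z | L - k < r z] by apply: GU; exists (setT, k) => [|z []//];
    split => //; exact: filterT.
  have h2 := FU _ (LP _ k0).
  apply: filterS2 h1 h2 => z /= z1 z2; rewrite ler_norml; lra.
have [h [hP h0 hpos hh]] := green_ultra_limit UU FU.
have UP := @ultra_proper _ _ UU.
have hL : h (step a) = L by apply: cvg_unique (hP (step a)) rU.
suff -> : L = 1 by [].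
apply: (harmonic_pos_max (h := h) (a := a) d0) => //; last by rewrite h0 mulr1.
(* Eventually [r (z + x) <= L + k / h x]; along [U] this becomes [h (x + step a) <= L * h x + k]. *)
move=> x; apply/ler_addgt0Pr => k k0.
have -> : L * h x + k = (L + k / h x) * h x by rewrite mulrDl divfK ?gt_eqF.
have l2 : (L + k / h x) * (g (z + x) / g z) @[z --> U] --> (L + k / h x) * h x.
  exact: cvgMl_tmp.
rewrite -subr_ge0; apply: (cvgr_to_ge (cvgB l2 (hP (x + step a)))).
have h1 : \forall z \near F, r (z + x) <= L + k / h x.
  by apply: (@cvg_translate_infty x _ (LP (k / h x) _)); rewrite divr_gt0.
have := FU _ h1; apply: filterS => z /=; rewrite /r ler_pdivrMr ?green_gt0// => zx.
by rewrite subr_ge0 addrA mulrA ler_pM2r ?invr_gt0 ?green_gt0.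
Qed.

(** The lower bound is the upper bound for the opposite step, taken from [z + step a] back to
    [z]. *)
Lemma green_ratio_step a : g (z + step a) / g z @[z --> F] --> (1 : R).
Proof.
apply/cvgrPdist_le => e e0.
have h1 := green_ratio_ub a e0.
have h2 : \forall z \near F, g (z + step a + step (flip a)) / g (z + step a) <= 1
  + e.
  exact: (@cvg_translate_infty (step a) _ (green_ratio_ub (flip a) e0)).
apply: filterS2 h1 h2 => z /=; rewrite step_flip addrK => z1.
rewrite ler_pdivrMr ?green_gt0// mulrDl mul1r => z2.
have gz := green_gt0 z.
have : 1 <= (1 + e) * (g (z + step a) / g z).
  by rewrite mulrA ler_pdivlMr// mul1r mulrDl mul1r.
have : 0 < g (z + step a) / g z by rewrite divr_gt0 ?green_gt0.
by rewrite ler_norml; nra.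
Qed.

Lemma green_ratio x : g (z + x) / g z @[z --> F] --> (1 : R).
Proof.
apply: (lattice_ind (Q := fun x => g (z + x) / g z @[z --> F] --> (1 : R))) =>
  [|y a IH].
  under eq_fun do rewrite addr0 divff ?gt_eqF ?green_gt0//.
  exact: cvg_cst.
have h : g (z + y + step a) / g (z + y) @[z --> F] --> (1 : R).
  exact: cvg_comp (cvg_translate_infty y) (@green_ratio_step a).
have -> : (fun z => g (z + (y + step a)) / g z) =
    (fun z => g (z + y + step a) / g (z + y) * (g (z + y) / g z)).
  by apply/funext => z; rewrite addrA mulrA divfK ?gt_eqF ?green_gt0.
by rewrite -[X in _ --> X]mulr1; exact: cvgM.
Qed.

End RatioLimit.

(** * Hitting functions and equilibrium measures *)

Section Hitting.
Variables (R : realType) (d : nat).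
Implicit Types (x y z : lattice d) (f g v : lattice d -> R) (s t : seq (lattice d)).

(** The probability that the walk from [x] meets [s] at a time strictly less than [n], by
    conditioning on the first step. *)
Fixpoint hit_within s n x : R :=
  if n is m.+1 then if x \in s then 1 else average (hit_within s m) x else 0.

Definition is_hitting s v := forall x, hit_within s n x @[n --> \oo] --> v x.

Lemma hit_within_translate s z n x :
  hit_within (map (+%R z) s) n (z + x) = hit_within s n x.
Proof.
elim: n x => //= n IH x; rewrite mem_map; last exact: addrI.
case: ifP => // _; rewrite /average; congr (_ * _).
by apply: eq_bigr => a _; rewrite -addrA IH.
Qed.

Lemma is_hitting_unique s v w : is_hitting s v -> is_hitting s w -> v = w.
Proof. by move=> hv hw; apply/funext => x; exact: cvg_unique (hv x) (hw x). Qed.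

Lemma is_hitting_translate s z v : is_hitting s v ->
  is_hitting (map (+%R z) s) (fun x => v (x - z)).
Proof.
move=> hv x; rewrite -{1}(subrK z x) addrC.
under eq_fun do rewrite hit_within_translate.
exact: hv.
Qed.

Hypothesis d3 : (3 <= d)%N.
Let d0 : (0 < d)%N. Proof. exact: leq_trans d3. Qed.
Let F := lattice_infty R d.
Let FP : ProperFilter F. Proof. exact: lattice_infty_proper. Qed.

Lemma hit_within_itv s n x : 0 <= hit_within s n x <= 1.
Proof.
elim: n x => [|n IH] x /=; first by rewrite lexx ler01.
case: ifP => _; first by rewrite lexx ler01.
rewrite mulr_ge0 ?invr_ge0 ?sumr_ge0//=; last by move=> a _;
  have /andP[] := IH (x + step a).
by rewrite -(average_cst d0 1 x); apply: ler_average => // y; have /andP[] := IH y.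
Qed.

Lemma harmonic_vanishing_ge0 f : is_harmonic f ->
  f x @[x --> F] --> (0 : R) -> forall x, 0 <= f x.
Proof.
move=> fh f0 x; rewrite leNgt; apply/negP => fx.
have [phi [phi0 phiS phiC]] := lyapunov R d3.
(* Then [k * phi x = - f x / 2], so [G x = f x / 2] is still negative while [G] is strictly
   superharmonic and tends to 0. *)
pose k := - f x / (2 * phi x).
have k0 : 0 < k by rewrite divr_gt0 ?mulr_gt0 ?oppr_gt0.
pose G y := f y + k * phi y.
have Gx : G x < 0.
  by rewrite /G /k invfM mulrA divfK ?gt_eqF//; lra.
apply: (@no_strict_superharmonic R d d0 G x) => [y|].
  by rewrite averageD averageZ fh ltrD2l ltr_pM2l.
have GC : G y @[y --> F] --> (0 : R).
  by rewrite -[X in _ --> X](addr0 0) -[X in _ + X](mulr0 k); apply: cvgD => //;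
    exact: cvgMl_tmp.
have /lattice_inftyE : F [set y | G x < G y].
  exact: cvgr_gt GC _ Gx.
by apply: sub_finite_set => y /= Gy; apply/negP; rewrite -leNgt.
Qed.

Lemma harmonic_vanishing f : is_harmonic f ->
  f x @[x --> F] --> (0 : R) -> forall x, f x = 0.
Proof.
move=> fh f0 x; apply/eqP; rewrite eq_le harmonic_vanishing_ge0// andbT.
rewrite -oppr_ge0; apply: (harmonic_vanishing_ge0 (f := fun x => - f x)) => [y|].
  by rewrite /average sumrN mulrN -/(average f y) fh.
by rewrite -[X in _ --> X]oppr0; exact: cvgN.
Qed.

(** The right-hand side is superharmonic and at least 1 on [s], hence dominates every stage of the
    recursion. *)
Lemma hit_within_le_lyapunov (phi : lattice d -> R) s n x :
  (forall x, 0 < phi x) -> (forall x, average phi x < phi x) ->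
  hit_within s n x <= \sum_(a <- s) phi (x - a) / phi 0.
Proof.
move=> phi0 phiS; have pos y a : 0 <= phi (y - a) / phi 0 by rewrite divr_ge0// ltW.
elim: n x => [|n IH] x /=; first by rewrite sumr_ge0.
case: ifPn => [xs|_].
  by rewrite (big_rem x)//= subrr divff ?gt_eqF// lerDl sumr_ge0.
apply: le_trans (ler_average d0 x IH) _.
rewrite average_sum ler_sum// => a _.
have -> : average (fun y => phi (y - a) / phi 0) x = average phi (x - a) / phi 0.
  by rewrite -(average_translate phi (- a)) /average -mulr_suml mulrA.
by rewrite ler_pM2r ?invr_gt0// ltW.
Qed.

Section HittingFunction.
Variables (s : seq (lattice d)) (v : lattice d -> R).
Hypothesis vP : is_hitting s v.

Lemma hitting_rec x : v x = if x \in s then 1 else average v x.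
Proof.
have h : hit_within s n.+1 x @[n --> \oo] --> v x.
  by rewrite (cvg_shiftS (hit_within s ^~ x)); exact: vP.
suff h2 : hit_within s n.+1 x @[n --> \oo] --> (if x \in s then 1 else average v x).
  exact: cvg_unique h h2.
rewrite /=; case: ifP => _; first exact: cvg_cst.
by apply: cvg_average => y; exact: vP.
Qed.

Lemma hitting_itv x : 0 <= v x <= 1.
Proof.
apply/andP; split.
  by apply: (cvgr_to_ge (@vP x)); apply: nearW => n;
    have /andP[] := hit_within_itv s n x.
by apply: (cvgr_to_le (@vP x)); apply: nearW => n;
  have /andP[] := hit_within_itv s n x.
Qed.

Lemma hitting_cvg0 : v x @[x --> F] --> (0 : R).
Proof.
have [phi [phi0 phiS phiC]] := lyapunov R d3.
have h : \sum_(a <- s) phi (x - a) / phi 0 @[x --> F] --> (0 : R).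
  rewrite -[X in _ --> X](_ : \sum_(a <- s) 0 / phi 0 = 0); last first.
    by rewrite big1// => a _; rewrite mul0r.
  apply: cvg_big => [|a _]; first exact: add_continuous.
  by apply: cvgMr_tmp; exact: cvg_comp (cvg_translate_infty (- a)) phiC.
apply: (squeeze_cvgr _ (cvg_cst 0) h); apply: nearW => x.
have /andP[-> _] /= := hitting_itv x.
apply: (cvgr_to_le (@vP x)); apply: nearW => n; exact: hit_within_le_lyapunov.
Qed.

(* For [x] in [s], the probability that the walk from [x] never returns to [s]. *)
Definition equilibrium x : R := v x - average v x.

Lemma equilibrium_out x : x \notin s -> equilibrium x = 0.
Proof. by move=> xs; rewrite /equilibrium {1}hitting_rec (negbTE xs) subrr. Qed.

Lemma equilibrium_itv x : 0 <= equilibrium x <= 1.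
Proof.
have [xs|/equilibrium_out ->] := boolP (x \in s); last by rewrite lexx ler01.
rewrite /equilibrium hitting_rec xs.
have : 0 <= average v x <= 1; last by lra.
apply/andP; split.
  by rewrite mulr_ge0 ?invr_ge0// sumr_ge0// => a _;
    have /andP[] := hitting_itv (x + step a).
by rewrite -(average_cst d0 1 x); apply: ler_average => // y;
  have /andP[] := hitting_itv y.
Qed.

Variables (g : lattice d -> R) (gP : is_green g) (us : uniq s).

(** Applying identity minus average gives [equilibrium] on both sides, as [g] yields [delta0]. The
    difference is thus harmonic and vanishes at infinity, so it is 0. *)
Lemma hitting_green x : v x = \sum_(a <- s) equilibrium a * g (x - a).
Proof.
apply/eqP; rewrite -subr_eq0; apply/eqP; move: x.
apply: harmonic_vanishing => [x|].
  rewrite averageB average_sum.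
  under eq_bigr do rewrite averageZ average_translate.
  have -> : \sum_(a <- s) equilibrium a * g (x - a) =
    equilibrium x + \sum_(a <- s) equilibrium a * average g (x - a).
    under eq_bigr do rewrite (green_average gP) mulrDr.
    rewrite big_split/=; congr (_ + _).
    have [xs|xs] := boolP (x \in s).
      rewrite (bigD1_seq x)//= subrr /delta0 eqxx mulr1 big1 ?addr0// => a ax.
      by rewrite subr_eq0 eq_sym (negbTE ax) mulr0.
    rewrite equilibrium_out// big_seq big1// => a as_.
    rewrite /delta0 subr_eq0 (_ : (x == a) = false) ?mulr0//.
    by apply: contraNF xs => /eqP ->.
  by rewrite /equilibrium; ring.
rewrite -[X in _ --> X](subr0 0); apply: cvgB; first exact: hitting_cvg0.
rewrite -[X in _ --> X](_ : \sum_(a <- s) equilibrium a * 0 = 0); last first.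
  by rewrite big1// => a _; rewrite mulr0.
apply: cvg_big => [|a _]; first exact: add_continuous.
by apply: cvgMl_tmp; exact: cvg_comp (cvg_translate_infty (- a)) (cvg_green d3 gP).
Qed.

Definition equilibrium_mass : R := \sum_(a <- s) equilibrium a.

Lemma cvg_hitting_green : v x / g x @[x --> F] --> equilibrium_mass.
Proof.
under eq_fun => x do rewrite hitting_green mulr_suml.
apply: cvg_big => [|a _]; first exact: add_continuous.
have : equilibrium a * (g (x - a) / g x) @[x --> F] --> equilibrium a * 1.
  by apply: cvgMl_tmp; exact: green_ratio.
by rewrite mulr1; under eq_fun do rewrite mulrA.
Qed.

End HittingFunction.
End Hitting.

(** * The capacity defect *)

(** The weights are bounded but not known to converge one by one, so the statement compares with [l]
    times their sum instead of naming a limit. *)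
Lemma cvg_weighted_sum (R : realType) (T I : Type) (F : set_system T)
    {FF : Filter F} (s : seq I) (w f : I -> T -> R) (l : R) :
  (forall i z, 0 <= w i z <= 1) -> (forall i, f i z @[z --> F] --> l) ->
  \sum_(i <- s) w i z * f i z - l * \sum_(i <- s) w i z @[z --> F] --> (0 : R).
Proof.
move=> w01 fl.
have -> : (fun z => \sum_(i <- s) w i z * f i z - l * \sum_(i <- s) w i z) =
    (fun z => \sum_(i <- s) w i z * (f i z - l)).
  apply/funext => z; rewrite mulr_sumr -sumrB; apply: eq_bigr => i _; ring.
rewrite -[X in _ --> X](_ : \sum_(i <- s) 0 = 0); last by rewrite big1.
apply: cvg_big => [|i _]; first exact: add_continuous.
apply: norm_cvg0; apply: (@squeeze_cvgr _ _ _ _ (cst 0) (fun z => `|f i z - l|)).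
- apply: nearW => z; rewrite normr_ge0 normrM /=.
  by have /andP[w0 w1] := w01 i z; rewrite ger0_norm// ler_piMl.
- exact: cvg_cst.
- rewrite -[X in _ --> X](normr0 R); apply: cvg_norm.
  by rewrite -[X in _ --> X](subrr l); apply: cvgB => //; exact: cvg_cst.
Qed.

Section Capacity.
Variables (R : realType) (d : nat) (d3 : (3 <= d)%N).
Variables (g : lattice d -> R) (gP : is_green g).
Variables (V : seq (lattice d) -> lattice d -> R).
Hypothesis VP : forall s, is_hitting s (V s).
Implicit Types (x y z : lattice d) (s t : seq (lattice d)).

Let d0 : (0 < d)%N. Proof. exact: leq_trans d3. Qed.
Let F := lattice_infty R d.
Let FP : ProperFilter F. Proof. exact: lattice_infty_proper. Qed.
Let e s x := equilibrium (V s) x.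
Let cap s := equilibrium_mass s (V s).

(* Both sides are [sum_(a, c) e_s a * g (a - c) * e_t c], as [V t = 1] on [s]. *)
Lemma cap_reciprocity s t : uniq s -> uniq t -> {subset s <= t} ->
  cap s = \sum_(c <- t) e t c * V s c.
Proof.
move=> us ut st.
under eq_bigr do rewrite (hitting_green d3 (VP (s := s)) gP us) mulr_sumr.
rewrite exchange_big /cap /equilibrium_mass /= !big_seq; apply: eq_bigr => a as_.
have {1}-> : equilibrium (V s) a = equilibrium (V s) a * V t a.
  by rewrite (hitting_rec (VP (s := t))) st// mulr1.
rewrite (hitting_green d3 (VP (s := t)) gP ut) mulr_sumr; apply: eq_bigr => c _.
by rewrite -(green_opp gP) opprB /e; ring.
Qed.

Lemma hitting_translate s z x : V (map (+%R z) s) x = V s (x - z).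
Proof.
by have -> := is_hitting_unique (@VP (map (+%R z) s)) (@is_hitting_translate R d
  s z _ (@VP s)).
Qed.

Lemma cap_translate s z : cap (map (+%R z) s) = cap s.
Proof.
rewrite /cap /equilibrium_mass big_map; apply: eq_bigr => a _.
rewrite /equilibrium hitting_translate addrAC subrr add0r; congr (_ - _).
rewrite /average; congr (_ * _); apply: eq_bigr => b _.
by rewrite hitting_translate -(addrA z) addrAC subrr add0r.
Qed.

(** It suffices that [z] avoids the finitely many differences [a - b]. *)
Lemma near_disjoint_translate s t :
  \forall z \near F, forall a, a \in s -> a \notin map (+%R z) t.
Proof.
have h : \forall z \near F, forall p,
  p \in allpairs (fun a b => a - b) s t -> z != p.
  elim: (allpairs _ _ _) => [|p r IH]; first exact: nearW.
  have hp := @near_lattice_infty_neq R d p.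
  apply: filterS2 hp IH => z zp zr q; by rewrite inE => /predU1P[->|/zr].
apply: filterS h => z zst a as_; apply/negP => /mapP[b bt ab].
have /negP := zst (a - b) (allpairs_f _ as_ bt); apply.
by rewrite ab addrK.
Qed.

Lemma capacity_defect s t : uniq s -> uniq t ->
  (cap s + cap t - cap (s ++ map (+%R z) t)) / g z @[z --> F]
    --> 2 * cap s * cap t.
Proof.
move=> us ut.
pose u z := s ++ map (+%R z) t.
have e01 z x : 0 <= e (u z) x <= 1 by exact: (equilibrium_itv d3 (@VP (u z))).
(* Reciprocity inside [u z], for [s] and for the translate of [t]; each hitting function is 1 on its
   own set. *)
have dec z : (forall a, a \in s -> a \notin map (+%R z) t) ->
  cap s = \sum_(a <- s) e (u z) a + \sum_(b <- t) e (u z) (z + b) * V s (z + b) /\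
  cap t = \sum_(a <- s) e (u z) a * V t (a - z) + \sum_(b <- t) e (u z) (z + b).
  move=> dis.
  have ut' : uniq (map (+%R z) t) by rewrite map_inj_uniq//; exact: addrI.
  have uu : uniq (u z).
    rewrite cat_uniq us ut' andbT/=; apply/hasPn => b bt; apply/negP => /dis.
    by rewrite bt.
  split.
    rewrite (@cap_reciprocity s (u z))//; last by move=> a as_; rewrite mem_cat as_.
    rewrite big_cat big_map/= big_seq [in RHS]big_seq; congr (_ + _).
    by apply: eq_bigr => a as_; rewrite (hitting_rec (@VP s)) as_ mulr1.
  rewrite -(cap_translate t z) (@cap_reciprocity _ (u z))//; last first.
    by move=> a as_; rewrite mem_cat as_ orbT.
  rewrite big_cat big_map/=; congr (_ + _).
    by apply: eq_bigr => a _; rewrite hitting_translate.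
  rewrite big_seq [in RHS]big_seq; apply: eq_bigr => b bt.
  by rewrite (hitting_rec (@VP _)) map_f// mulr1.
have FF : Filter F by exact: lattice_infty_filter.
have ndis := near_disjoint_translate s t.
have trB b : z + b @[z --> F] --> F by exact: cvg_translate_infty.
have trA a : a - z @[z --> F] --> F.
  by apply: cvg_lattice_infty_inj => x y /addrI /oppr_inj.
have Vs b : V s (z + b) / g z @[z --> F] --> cap s.
  have -> : (fun z => V s (z + b) / g z) =
      (fun z => V s (z + b) / g (z + b) * (g (z + b) / g z)).
    by apply/funext => z; rewrite mulrA divfK ?gt_eqF ?(green_gt0 d3 gP).
  rewrite -[X in _ --> X]mulr1; apply: cvgM; last exact: green_ratio.
  exact: cvg_comp (trB b) (cvg_hitting_green d3 (@VP s) gP us).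
have Vt a : V t (a - z) / g z @[z --> F] --> cap t.
  have -> : (fun z => V t (a - z) / g z) =
      (fun z => V t (a - z) / g (a - z) * (g (z - a) / g z)).
    apply/funext => z; rewrite -(green_opp gP (z - a)) opprB mulrA divfK//.
    by rewrite gt_eqF ?(green_gt0 d3 gP).
  rewrite -[X in _ --> X]mulr1; apply: cvgM; last exact: green_ratio.
  exact: cvg_comp (trA a) (cvg_hitting_green d3 (@VP t) gP ut).
have Vs0 b : V s (z + b) @[z --> F] --> (0 : R).
  exact: cvg_comp (trB b) (hitting_cvg0 d3 (@VP s)).
have Vt0 a : V t (a - z) @[z --> F] --> (0 : R).
  exact: cvg_comp (trA a) (hitting_cvg0 d3 (@VP t)).
(* In the second identity of [dec] the other sum vanishes in the limit, having bounded weights and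
   factors [V t (a - z)] tending to 0. *)
have Wt : \sum_(b <- t) e (u z) (z + b) @[z --> F] --> cap t.
  have := cvg_weighted_sum (FF := FF) s (w := fun a z => e (u z) a) (fun a z =>
    e01 z a) Vt0.
  under eq_fun do rewrite mul0r subr0.
  move=> h; have h3 : cap t - \sum_(a <- s) e (u z) a * V t (a - z) @[z --> F]
    --> cap t.
    by rewrite -[X in _ --> X]subr0; apply: cvgB => //; exact: cvg_cst.
  apply: cvg_trans h3; apply: near_eq_cvg;
    apply: filterS ndis => z /dec[_ ->] /=; ring.
have Ws : \sum_(a <- s) e (u z) a @[z --> F] --> cap s.
  have := cvg_weighted_sum (FF := FF) t (w := fun b z => e (u z) (z + b)) (fun b
    z => e01 z (z + b)) Vs0.
  under eq_fun do rewrite mul0r subr0.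
  move=> h; have h3 : cap s - \sum_(b <- t) e (u z) (z + b) * V s (z + b) @[z -->
    F] --> cap s.
    by rewrite -[X in _ --> X]subr0; apply: cvgB => //; exact: cvg_cst.
  apply: cvg_trans h3; apply: near_eq_cvg;
    apply: filterS ndis => z /dec[-> _] /=; ring.
have h1 := cvg_weighted_sum (FF := FF) t (w := fun b z => e (u z) (z + b)) (fun b
  z => e01 z (z + b)) Vs.
have h2 := cvg_weighted_sum (FF := FF) s (w := fun a z => e (u z) a) (fun a z =>
  e01 z a) Vt.
(* Adding [cap s] and [cap t] times the weight sums undoes the subtractions in [h1] and [h2]; each
   contributes [cap s * cap t] to the limit. *)
have h3 := cvgD (FF := FF) (cvgD (FF := FF) h1 (cvgMl_tmp (FF := FF) (a := cap s)
  Wt))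
  (cvgD (FF := FF) h2 (cvgMl_tmp (FF := FF) (a := cap t) Ws)).
move: h3; rewrite !add0r (_ : _ + _ = 2 * cap s * cap t); last by ring.
move=> h3; apply: cvg_trans h3; apply: near_eq_cvg; apply: filterS ndis => z dis /=.
have [sE tE] := dec z dis.
have uE : cap (u z) = \sum_(a <- s) e (u z) a + \sum_(b <- t) e (u z) (z + b).
  by rewrite /cap /equilibrium_mass big_cat big_map.
rewrite !subrK uE {1}sE {1}tE.
transitivity ((\sum_(b <- t) e (u z) (z + b) * V s (z + b)) / g z +
    (\sum_(a <- s) e (u z) a * V t (a - z)) / g z).
  by rewrite !mulr_suml; congr (_ + _); apply: eq_bigr => i _; rewrite mulrA.
by rewrite -mulrDl; congr (_ / _); ring.
Qed.

End Capacity.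

(** * From the walk to the averaging operator *)

Section Markov.
Context {disp : measure_display} {T : measurableType disp} {R : realType}.
Variables (P : probability T R) (d : nat) (S : nat -> T -> lattice d).
Hypotheses (d0 : (0 < d)%N) (hS : simple_random_walk P S).
Implicit Types (x y z : lattice d) (a : bool * 'I_d) (W : set T).

Let c : R := (2 * d)%:R^-1.

Definition step_event n a : set T := increment S n @^-1` [set step a].

Fixpoint word_event n (w : seq (bool * 'I_d)) : set T :=
  if w is a :: w' then step_event n a `&` word_event n.+1 w' else setT.

Fixpoint sojourn_event n (Fs : seq (set (lattice d))) : set T :=
  if Fs is E :: Fs' then S n @^-1` E `&` sojourn_event n.+1 Fs' else setT.

(** The probability that the walk from [x] lies in the successive sets of [Fs] at times 0, 1, and so
    on. This covers both the law of [S n] and the avoidance of a set. *)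
Fixpoint sojourn_value (Fs : seq (set (lattice d))) x : R :=
  if Fs is E :: Fs' then (x \in E)%:R * average (sojourn_value Fs') x else 1.

(* It suffices to test independence of the increments from time [n] on
   against cylinder events of unit steps, which carry the whole mass. *)
Definition past_event n W := measurable W /\
  forall w, P (W `&` word_event n w) = (P W * (c ^+ size w)%:E)%E.

(** Measurability is given for positions, so the event is split over the countably many values of
    [S n]. *)
Lemma measurable_step_event n a : measurable (step_event n a).
Proof.
have -> : step_event n a =
    \bigcup_x (S n @^-1` [set x] `&` S n.+1 @^-1` [set x + step a]).
  apply/seteqP; split => [w /= h|w [x _ [/= <- h]]]; last first.
    by rewrite /step_event /increment/= h addrC addKr.
  exists (S n w) => //; split => //=.
  by rewrite -h /increment addrC subrK.
apply: countable_bigcupT_measurable; first exact: countableP.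
by move=> x; apply: measurableI; exact: srw_measurable hS _ _.
Qed.

Lemma trivIset_step_event n (D : set (bool * 'I_d)) : trivIset D (step_event n).
Proof.
by apply/trivIsetP => a b _ _ ab; apply/seteqP; split => // w [h1 h2];
  have /step_inj/eqP := etrans (esym h1) h2; rewrite (negbTE ab).
Qed.

Lemma measurable_sojourn_event n Fs : measurable (sojourn_event n Fs).
Proof.
elim: Fs n => [|E Fs IH] n /=; first exact: measurableT.
by apply: measurableI => //; exact: srw_measurable hS _ _.
Qed.

(** Puts the event in the form of [mutually_independent]. The default of [nth] is never read, since
    [j - n < size w]. *)
Lemma word_eventE n w : word_event n w =
  \bigcap_(j in [set` seq_fset tt (iota n (size w))])
    (increment S j @^-1` [set step (nth (true, Ordinal d0) w (j - n))]).
Proof.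
have jE s j : [set` seq_fset tt s] j = (j \in s) by rewrite -(seq_fsetE tt).
apply/seteqP; elim: w n => [|a w IH] n.
  by split => // x _ j; rewrite jE.
have shift j : j \in iota n.+1 (size w) ->
    nth (true, Ordinal d0) (a :: w) (j - n) = nth (true, Ordinal d0) w (j - n.+1).
  by rewrite mem_iota => /andP[nj _]; rewrite (_ : (j - n = (j - n.+1).+1)%N)//;
    lia.
split=> [x [xa xw] j|x h].
  rewrite jE inE => /predU1P[->|jw]; first by rewrite subnn.
  by have := (IH n.+1).1 x xw j; rewrite jE => /(_ jw) h; rewrite shift.
split; first by have := h n; rewrite jE inE eqxx subnn; exact.
apply: (IH n.+1).2 => j; rewrite jE => jw.
by have := h j; rewrite jE inE jw orbT shift//; exact.
Qed.

Lemma prob_word_event n w : P (word_event n w) = (c ^+ size w)%:E.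
Proof.
rewrite word_eventE (srw_indep hS).
rewrite (eq_bigr (fun=> c%:E)); last first.
  by move=> j _; exact: srw_uniform hS _ _ (unit_steps_step _).
rewrite big_const_seq count_predT size_seq_fset undup_id ?iota_uniq// size_iota.
by elim: (size w) => //= k ->; rewrite -EFinM exprS.
Qed.

Lemma past_event0 : past_event 0 setT.
Proof.
split; first exact: measurableT.
by move=> w; rewrite setTI probability_setT mul1e prob_word_event.
Qed.

Lemma prob_step n a W : past_event n W -> P (W `&` step_event n a) = (P W * c%:E)%E.
Proof. by move=> [_ /(_ [:: a])] /=; rewrite setIT expr1. Qed.

Lemma past_event_step n a W : past_event n W ->
  past_event n.+1 (W `&` step_event n a).
Proof.
move=> WP; have [mW hW] := WP; split.
  by apply: measurableI => //; exact: measurable_step_event.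
move=> w; have := hW (a :: w); rewrite /= setIA => ->.
by rewrite prob_step// exprS EFinM muleA.
Qed.

(** The [2 * d] disjoint step events have probability [c] each, so they exhaust the mass and their
    complement is null. *)
Lemma prob_total_step n W : measurable W ->
  P W = (\sum_a P (W `&` step_event n a))%E.
Proof.
move=> mW; pose U := \bigcup_a step_event n a.
have mU : measurable U.
  by apply: countable_bigcupT_measurable;
    [exact: countableP|exact: measurable_step_event].
have sumE (G : bool * 'I_d -> set T) : trivIset setT G -> (forall a,
  measurable (G a)) ->
    P (\bigcup_a G a) = (\sum_a P (G a))%E.
  move=> tG mG; rewrite measure_fin_bigcup//; last exact: finite_finset.
  rewrite [in RHS](bigfs _ (P := predT)) ?index_enum_uniq//; last first.
    by move=> i _; rewrite mem_index_enum.
  by apply: eq_fsbigl; apply/seteqP; split.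
have PU : P U = 1%E.
  rewrite sumE; [|exact: trivIset_step_event|exact: measurable_step_event].
  under eq_bigr => a _ do rewrite (srw_uniform hS n (unit_steps_step a)).
  rewrite sumEFin sumr_const card_step -(mulr_natl (2 * d)%:R^-1) mulfV//.
  by rewrite gt_eqF// d2_gt0.
have PU0 : P (~` U) = 0%E by rewrite probability_setC// PU subee.
have WU : P W = P (W `&` U).
  rewrite -[in LHS](setIT W) -(setUv U) setIUr measureU.
  - suff e0 : P (W `&` ~` U) = 0%E by rewrite [X in (_ + X)%E]e0 adde0.
    apply: (@subset_measure0 _ _ _ P _ (~` U)) => //.
    + by apply: measurableI => //; exact: measurableC.
    + exact: measurableC.
  - exact: measurableI.
  - by apply: measurableI => //; exact: measurableC.
  - by rewrite setIACA setICr setI0.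
rewrite WU setI_bigcupr sumE//.
- by apply: trivIset_setIl; exact: trivIset_step_event.
- by move=> a; apply: measurableI => //; exact: measurable_step_event.
Qed.

(** The Markov property, by induction on [Fs]: after a step [a], the event [W] becomes a past event
    at time [n.+1] located at [x + step a]. *)
Lemma past_event_start n W x : past_event n W -> W `<=` S n @^-1` [set x] ->
  forall Fs, P (W `&` sojourn_event n Fs) = (P W * (sojourn_value Fs x)%:E)%E.
Proof.
move=> + + Fs; elim: Fs n W x => [|E Fs IH] n W x WP Wx /=.
  by rewrite setIT mule1.
have [mW _] := WP.
have [xE|xE] := boolP (x \in E); last first.
  rewrite mul0r mule0 (_ : _ `&` _ = set0) ?measure0//.
  apply/seteqP; split => // w [Ww [/= SE _]].
  by move/negP: xE; apply; rewrite inE -(Wx w Ww).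
rewrite mul1r setIA (_ : W `&` _ = W); last first.
  by apply/setIidPl => w /Wx /= ->; exact: set_mem.
rewrite (prob_total_step n); last first.
  by apply: measurableI => //; exact: measurable_sojourn_event.
have step_value a : P (W `&` sojourn_event n.+1 Fs `&` step_event n a) =
    (P W * c%:E * (sojourn_value Fs (x + step a))%:E)%E.
  rewrite setIAC (IH _ _ (x + step a)) ?prob_step//; first exact: past_event_step.
  by move=> w [/Wx /= <- /= <-]; rewrite /increment addrC subrK.
under eq_bigr => a _ do rewrite step_value.
have -> : P W = (fine (P W))%:E by rewrite fineK// fin_num_measure.
by rewrite sumEFin -EFinM -mulr_sumr mulrA.
Qed.

Lemma prob_sojourn_event Fs : P (sojourn_event 0 Fs) = (sojourn_value Fs 0)%:E.
Proof.
rewrite -[sojourn_event 0 Fs]setTI (past_event_start past_event0 (x := 0)).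
  by rewrite probability_setT mul1e.
by move=> w _; exact: srw_start hS w.
Qed.

(** Averaging acts on the starting point [y] and produces the iterate at [y - x]; for [y = 0]
    symmetry replaces [- x] by [x]. *)
Lemma sojourn_value_hit n x :
  sojourn_value (nseq n setT ++ [:: [set x]]) 0 = iter n (@average R d) (@delta0
    R d) x.
Proof.
have h y : sojourn_value (nseq n setT ++ [:: [set x]]) y =
    iter n (@average R d) (@delta0 R d) (y - x).
  elim: n y => [|n IH] y /=.
    by rewrite average_cst// mulr1 /delta0 subr_eq0; congr (_%:R);
      congr nat_of_bool; apply/idP/eqP; rewrite inE.
  rewrite in_setT mul1r -(average_translate _ (- x)); rewrite /average;
    congr (_ * _).
  by apply: eq_bigr => a _; exact: IH.
by rewrite h sub0r iter_average_opp.
Qed.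

Lemma prob_position n x :
  P (S n @^-1` [set x]) = (iter n (@average R d) (@delta0 R d) x)%:E.
Proof.
rewrite -sojourn_value_hit -prob_sojourn_event; congr (P _).
have h m : sojourn_event m (nseq n setT ++ [:: [set x]]) = S (m + n) @^-1` [set x].
  elim: n m => [|n IH] m /=; first by rewrite setIT addn0.
  by rewrite preimage_setT setTI IH addSnnS.
by rewrite h.
Qed.

Lemma sojourn_value_avoid s n z x :
  sojourn_value (nseq n [set y | z + y \notin s]) x = 1 - hit_within R s n (z + x).
Proof.
elim: n x => [|n IH] x /=; first by rewrite subr0.
have -> : (x \in [set y | z + y \notin s]) = (z + x \notin s).
  by apply/idP/idP; rewrite inE.
case: (z + x \in s); first by rewrite mul0r subrr.
rewrite mul1r -[X in X - _](average_cst d0 1 x) -[in RHS](addrC x)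
  -average_translate -averageB.
by rewrite /average; congr (_ * _); apply: eq_bigr => a _; rewrite IH (addrC z).
Qed.

(** The events [G n] of a hit before time [n] increase to the hitting event, so continuity from
    below applies. *)
Lemma hitting_probability_is_hitting s :
  is_hitting s (fun z => hitting_probability P S z [set` s]).
Proof.
move=> z; pose G n := ~` sojourn_event 0 (nseq n [set y | z + y \notin s]).
have mG n : measurable (G n) by apply: measurableC; exact: measurable_sojourn_event.
have PG n : P (G n) = (hit_within R s n z)%:E.
  rewrite probability_setC; last exact: measurable_sojourn_event.
  by rewrite prob_sojourn_event sojourn_value_avoid addr0 -EFinB opprB addrC subrK.
have GE n : G n = [set w | exists2 k, (k < n)%N & z + S k w \in s].
  have h m : ~` sojourn_event m (nseq n [set y | z + y \notin s]) =
      [set w | exists2 k, (k < n)%N & z + S (m + k) w \in s].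
    elim: n m {mG PG} => [|n IH] m /=.
      by rewrite setCT; apply/seteqP; split => // w [].
    rewrite setCI IH; apply/seteqP; split => [w [/negP|[k kn]]|w [[|k]]] /=.
    - by rewrite negbK => h; exists 0%N => //; rewrite addn0.
    - by rewrite addSnnS => h; exists k.+1.
    - by rewrite addn0 => _ h; left; apply/negP; rewrite negbK.
    - by rewrite ltnS => kn; rewrite -addSnnS => h; right; exists k.
  by rewrite /G h.
have GU : [set w | translate z (walk_range S w) `&` [set` s] !=set0] = \bigcup_n
  G n.
  apply/seteqP; split => [w [y [[_ [k _ <-] <-] ks]]|w [n _]].
    by exists k.+1 => //; rewrite GE; exists k.
  rewrite GE => -[k _ ks]; exists (z + S k w); split => //.
  by exists (S k w) => //; exists k.
have PU : (P \o G) n @[n --> \oo] --> (fine (P (\bigcup_n G n)))%:E.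
  rewrite fineK; last by rewrite fin_num_measure//; exact: bigcupT_measurable.
  apply: nondecreasing_cvg_mu => //; first exact: bigcupT_measurable.
  apply/nondecreasing_seqP => n; apply/subsetPset => w; rewrite !GE => -[k kn ks].
  by exists k => //; exact: ltnW.
rewrite /hitting_probability GU.
have -> : (fun n => hit_within R s n z) = fine \o (P \o G).
  by apply/funext => n; rewrite /= PG.
exact: fine_cvg PU.
Qed.

End Markov.

(** * Green's function and capacity of the walk *)

Section GreenFunction.
Context {disp : measure_display} {T : measurableType disp} {R : realType}.
Variables (P : probability T R) (d : nat) (S : nat -> T -> lattice d).

Lemma green_is_green : (3 <= d)%N -> simple_random_walk P S -> is_green (green P S).
Proof.
move=> d3 hS x; have d0 : (0 < d)%N by exact: leq_trans d3.
suff -> : green P S x = limn (@partial_green R d ^~ x) by exact: cvg_partial_green.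
(* The partial sums converge in the reals, so [fine] meets a finite value. *)
rewrite /green; under eq_eseriesr do rewrite (prob_position d0 hS).
rewrite (_ : (fun _ => _) = EFin \o (@partial_green R d ^~ x)).
  by rewrite EFin_lim//; exact: cvg_partial_green.
by apply/funext => n; rewrite /= sumEFin big_mkord.
Qed.

End GreenFunction.

(** The ratio converges by [cvg_hitting_green], so the [lim] in [Cap] is a genuine limit. *)
Lemma Cap_equilibrium_mass (disp : measure_display) (T : measurableType disp)
    (R : realType) (P : probability T R) (d : nat) (S : nat -> T -> lattice d)
    (s : seq (lattice d)) :
  (3 <= d)%N -> simple_random_walk P S -> uniq s ->
  Cap P S [set` s] =
    equilibrium_mass s (fun z => hitting_probability P S z [set` s]).
Proof.
move=> d3 hS us; have d0 : (0 < d)%N by exact: leq_trans d3.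
have FP := lattice_infty_proper R d0.
apply: cvg_lim => //; apply: (cvg_hitting_green d3 _ (green_is_green d3 hS) us).
exact: hitting_probability_is_hitting.
Qed.

Lemma finite_set_uniq_seq (T : eqType) (A : set T) : finite_set A ->
  exists2 s : seq T, uniq s & A = [set` s].
Proof.
move=> /finite_seqP[s ->]; exists (undup s); first exact: undup_uniq.
by apply/seteqP; split => x /=; rewrite mem_undup.
Qed.

Theorem mainTheorem1
  (disp : measure_display) (T : measurableType disp) (R : realType)
  (P : probability T R) (d : nat) (hd : (3 <= d)%N)
  (S : nat -> T -> lattice d) (hS : simple_random_walk P S)
  (A B : set (lattice d)) (hA : finite_set A) (hB : finite_set B) :
  (Cap P S A + Cap P S B - Cap P S (A `|` translate z B)) / green P S z
    @[z --> lattice_infty R d] --> 2 * Cap P S A * Cap P S B.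
Proof.
have [s us ->] := finite_set_uniq_seq hA.
have [t ut ->] := finite_set_uniq_seq hB.
have d0 : (0 < d)%N by exact: leq_trans hd.
pose V u z := hitting_probability P S z [set` (u : seq (lattice d))].
have VP u : is_hitting u (V u) by exact: hitting_probability_is_hitting.
have defect := capacity_defect hd (green_is_green hd hS) VP us ut.
rewrite !Cap_equilibrium_mass//; apply: cvg_trans defect; apply: near_eq_cvg.
have FF := lattice_infty_filter R d.
(* Once the translate is disjoint from [s], concatenation enumerates the union without
   repetition. *)
apply: filterS (near_disjoint_translate R s t) => z dis /=.
have -> : [set` s] `|` translate z [set` t] = [set` s ++ map (+%R z) t].
  apply/seteqP; split => x /=; rewrite mem_cat.
    by case=> [->//|[b bt <-]]; rewrite map_f ?orbT.
  by case/orP => [|/mapP[b bt ->]]; [left|right; exists b].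
rewrite Cap_equilibrium_mass// cat_uniq us map_inj_uniq ?ut ?andbT;
  last exact: addrI.
by apply/hasPn => b bt; apply/negP => /dis; rewrite bt.
Qed.
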